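(* Let $n\ge 1$ and let $\alpha''\in T_n$ be given by $1\alpha''=1$ and $x\alpha''=\min(x+1,n)$ for all $x\in X_n$ with $x>1$. Then $$\langle C_n\cup\{\alpha''\}\rangle=O_n^{(1)},$$ where $O_n^{(1)}=\{\alpha\in O_n: 1\alpha=1\}$.
   Context: $X_n=\{1,2,\dots,n\}$ is the finite chain with its usual order, and $T_n$ is the full transformation semigroup of all maps $X_n\to X_n$. Maps are written on the right and composed left to right: $x(\alpha\beta)=(x\alpha)\beta$. $O_n=\{\alpha\in T_n: x\le y\Rightarrow x\alpha\le y\alpha \text{ for all } x,y\in X_n\}$ is the subsemigroup of order-preserving maps. The Catalan monoid is $C_n=\{\alpha\in O_n: x\alpha\le x \text{ for all } x\in X_n\}$. For a subset $A\subseteq T_n$, $\langle A\rangle$ denotes the subsemigroup of $T_n$ generated by $A$. *)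

(* Defs.v *)
From HB Require Import structures.
From mathcomp Require Import all_boot.

Set Implicit Arguments.
Unset Strict Implicit.
Unset Printing Implicit Defensive.

Local Open Scope group_scope.

(* The chain X_n = {1 < ... < n} is 'I_n, the ordinal i standing for the point
   i + 1; thus 1 is the ordinal of value 0 and n the ordinal of value n.-1. *)
Definition transf (n : nat) := {ffun 'I_n -> 'I_n}.

HB.instance Definition _ n := Finite.on (transf n).

Section TransfSemigroup.
Variable n : nat.
Implicit Types a b c : transf n.

(* Maps act on the right: x(ab) = (xa)b, where xa is written [a x]. *)
Definition transf_mul a b : transf n := [ffun x => b (a x)].

Lemma transf_mulA : associative transf_mul.
Proof. by move=> a b c; apply/ffunP=> x; rewrite !ffunE. Qed.

HB.instance Definition _ := isSemigroup.Build (transf n) transf_mulA.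

Lemma transf_mulE a b x : (a * b) x = b (a x).
Proof. by rewrite ffunE. Qed.

Definition subsemigroup (S : {set transf n}) : bool :=
  [forall a in S, forall b in S, a * b \in S].

Lemma subsemigroupP (S : {set transf n}) :
  reflect (mulg_closed S) (subsemigroup S).
Proof.
apply: (iffP forall_inP) => [SM a b aS bS | SM a aS].
  by move/forall_inP: (SM a aS); apply.
by apply/forall_inP=> b bS; apply: SM.
Qed.

Definition sgen (A : {set transf n}) : {set transf n} :=
  \bigcap_(S : {set transf n} | subsemigroup S && (A \subset S)) S.

End TransfSemigroup.

Section OrderPreserving.
Variable n : nat.

Definition order_preserving : {set transf n} :=
  [set a : transf n | [forall x : 'I_n, forall y : 'I_n, (x <= y) ==> (a x <= a y)]].

Definition catalan : {set transf n} :=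
  [set a in order_preserving | [forall x : 'I_n, a x <= x]].

Definition order_preserving1 : {set transf n} :=
  [set a in order_preserving |
    [forall x : 'I_n, (x == 0 :> nat) ==> (a x == x)]].

Lemma alpha''_subproof (x : 'I_n) :
  (if x == 0 :> nat then 0 else minn x.+1 n.-1) < n.
Proof.
have n_gt0 : 0 < n by apply: leq_ltn_trans (ltn_ord x).
by case: ifP => // _; rewrite -[ltnRHS](prednK n_gt0) ltnS geq_minr.
Qed.

Definition alpha'' : transf n := [ffun x => Ordinal (alpha''_subproof x)].

(* The defining formula in the 1-based labelling. *)
Lemma alpha''E (x : 'I_n) :
  (alpha'' x).+1 = (if x.+1 == 1 then 1 else minn x.+2 n)%N.
Proof.
have n_gt0 : 0 < n by apply: leq_ltn_trans (ltn_ord x).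
by rewrite ffunE /= eqSS; case: ifP => // _; rewrite -minnSS prednK.
Qed.

End OrderPreserving.

Arguments order_preserving n : clear implicits.
Arguments catalan n : clear implicits.
Arguments order_preserving1 n : clear implicits.
Arguments alpha'' n : clear implicits.

(* Main.v *)
(* If b is order-preserving, fixes the least point and has image v_0 < ... < v_r,
   then b = a * alpha''^k * c with k = n - (r + 1): the map a sends x to the
   index of x b among the v_i, alpha''^k shifts the nonzero indices up to
   i + k <= n - 1, and c sends i + k back down to v_i.  Here v_i <= i + k because
   only k points are missed by b, so a and c both belong to the Catalan monoid. *)
Require Import Defs.
From mathcomp Require Import all_boot.

Set Implicit Arguments.
Unset Strict Implicit.
Unset Printing Implicit Defensive.

Local Open Scope group_scope.

Section Generation.
Variable n : nat.
Implicit Types a b c : transf n.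

Lemma order_preservingP a :
  reflect (forall x y : 'I_n, x <= y -> a x <= a y) (a \in order_preserving n).
Proof.
rewrite inE; apply: (iffP forallP) => [aP x y xy | aP x].
  by move/forallP/(_ y)/implyP: (aP x); apply.
by apply/forallP=> y; apply/implyP; apply: aP.
Qed.

Lemma catalanP a :
  reflect (a \in order_preserving n /\ forall x, a x <= x) (a \in catalan n).
Proof. by rewrite [a \in catalan n]inE; apply: (iffP andP) => -[aO] /forallP. Qed.

Lemma order_preserving1P a :
  reflect (a \in order_preserving n /\ forall x : 'I_n, x = 0 :> nat -> a x = 0 :> nat)
          (a \in order_preserving1 n).
Proof.
rewrite [a \in order_preserving1 n]inE; apply: (iffP andP) => -[aO a0]; split=> //.
  by move=> x x0; move/forallP/(_ x): a0; rewrite x0 => /eqP->.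
by apply/forallP=> x; apply/implyP=> /eqP x0; rewrite -val_eqE /= x0 a0.
Qed.

Lemma mem_sgenP (A : {set transf n}) b :
  reflect (forall S : {set transf n}, mulg_closed S -> A \subset S -> b \in S)
          (b \in sgen A).
Proof.
apply: (iffP bigcapP) => [bP S SM AS | bP S /andP[/subsemigroupP SM AS]].
  by apply: bP; rewrite AS andbT; apply/subsemigroupP.
exact: bP.
Qed.

Lemma order_preserving1_mulg_closed : mulg_closed (order_preserving1 n).
Proof.
move=> a b /order_preserving1P[/order_preservingP aO a0].
move=> /order_preserving1P[/order_preservingP bO b0].
apply/order_preserving1P; split=> [|x x0]; last by rewrite transf_mulE b0 ?a0.
by apply/order_preservingP=> x y xy; rewrite !transf_mulE; apply/bO/aO.
Qed.

Lemma catalan_sub_order_preserving1 : catalan n \subset order_preserving1 n.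
Proof.
apply/subsetP=> a /catalanP[aO ax]; apply/order_preserving1P; split=> // x x0.
by apply/eqP; rewrite -leqn0 -x0.
Qed.

Lemma alpha''_order_preserving1 : alpha'' n \in order_preserving1 n.
Proof.
apply/order_preserving1P; split=> [|x x0]; last by rewrite ffunE /= x0.
apply/order_preservingP=> x y xy; rewrite !ffunE /=.
case: eqP => // x0; case: eqP => [y0|_]; first by rewrite y0 leqn0 in xy; case/eqP: xy.
by rewrite leq_min geq_minr andbT (leq_trans (geq_minl _ _)) ?ltnS.
Qed.

(** Under the bound, the truncation at [n.-1] never takes effect, so each factor adds 1 unless the
    value is 0, which stays fixed. Iterating from [a] covers [k = 0] without an identity map. *)
Lemma iter_mul_alpha''E a k (x : 'I_n) :
  a x + k < n ->
  iter k (fun b => b * alpha'' n) a x = (if a x == 0 :> nat then 0 else a x + k) :> nat.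
Proof.
elim: k => [|k IHk] lt_n; first by rewrite addn0 /=; case: eqP.
rewrite iterS transf_mulE ffunE /= IHk; last by rewrite (leq_trans _ lt_n) // addnS.
have [//|ax0] := eqVneq (a x : nat) 0; rewrite addn_eq0 (negPf ax0) /= -addnS.
by apply/minn_idPl; rewrite -ltnS prednK // (leq_ltn_trans _ lt_n).
Qed.

Lemma card_ord_ltn (m : 'I_n) : #|[set v : 'I_n | v < m]| = m.
Proof.
rewrite -sum1dep_card -(big_ord_widen _ (fun=> 1%N)) ?sum1_card ?card_ord //.
exact: ltnW.
Qed.

Section Factorization.
Variable b : transf n.
Hypothesis b_mono : forall x y : 'I_n, x <= y -> b x <= b y.

Let im : {set 'I_n} := [set b x | x : 'I_n].
Let rk (x : 'I_n) := #|[set v in im | v < b x]|.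
Let k := n - #|im|.

(** By monotonicity, an image point below [b x] is [b y] for some [y < x], and there are [x] such
    [y]. *)
Let rk_le x : rk x <= x.
Proof.
rewrite -[leqRHS]card_ord_ltn.
apply: leq_trans (leq_imset_card b _); apply/subset_leq_card/subsetP=> v.
rewrite inE => /andP[/imsetP[y _ ->] lt_b]; apply: imset_f; rewrite inE ltnNge.
by apply: contraL lt_b => /b_mono; rewrite -leqNgt.
Qed.

Let rk_leq x y : (rk x <= rk y) = (b x <= b y).
Proof.
apply/idP/idP => [|bxy].
  apply: contraLR; rewrite -!ltnNge => byx; apply: proper_card.
  apply/properP; split.
    by apply/subsetP=> v; rewrite !inE => /andP[-> /ltn_trans->].
  (* When [b y < b x], the point [b y] is counted by [rk x] but not by [rk y]. *)
  by exists (b y); rewrite !inE ?ltnn ?andbF // byx imset_f.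
apply/subset_leq_card/subsetP=> v; rewrite !inE => /andP[-> vx].
exact: leq_trans vx bxy.
Qed.

(** The point [b x] lies in [im] but is not counted by [rk x], so [rk x < #|im| = n - k]. *)
Let rk_lt x : rk x + k < n.
Proof.
have im_n : #|im| <= n by rewrite -[leqRHS]card_ord max_card.
rewrite addnC -ltn_subRL subKn //; apply: proper_card; apply/properP; split.
  by apply/subsetP=> v; rewrite inE => /andP[].
by exists (b x); rewrite ?imset_f // !inE ltnn andbF.
Qed.

(** Each of the [b x] points below [b x] either lies in [im], and is counted by [rk x], or is one of
    the [k] missed points. *)
Let b_le_rk x : b x <= rk x + k.
Proof.
have -> : k = #|~: im| by rewrite cardsCs setCK card_ord.
rewrite -[leqLHS]card_ord_ltn; apply: leq_trans (leq_card_setU _ _).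
by apply/subset_leq_card/subsetP=> v; rewrite !inE => ->; rewrite andbT orbN.
Qed.

(** Taking a maximum makes the inverse of [rk x + k] total and monotone; the empty maximum gives 0
    for [j < k]. *)
Let unrk (j : nat) := \max_(x : 'I_n | rk x + k <= j) b x.

Let unrk_le j : unrk j <= j.
(* The remaining bound [b x <= rk x + k] is [b_le_rk], taken from the context. *)
Proof. by apply/bigmax_leqP=> x; apply: leq_trans. Qed.

Let unrkK x : unrk (rk x + k) = b x.
Proof.
apply/eqP; rewrite eqn_leq (leq_bigmax_cond (F := fun y => b y : nat)) // andbT.
by apply/bigmax_leqP=> y; rewrite leq_add2r rk_leq.
Qed.

Lemma order_preserving_factorization :
    (forall x : 'I_n, x = 0 :> nat -> b x = 0 :> nat) ->
  exists a c m, [/\ a \in catalan n, c \in catalan n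
    & b = iter m (fun d => d * alpha'' n) a * c].
Proof.
move=> b0.
pose a : transf n := [ffun x => Ordinal (leq_ltn_trans (rk_le x) (ltn_ord x))].
pose c : transf n := [ffun x : 'I_n => Ordinal (leq_ltn_trans (unrk_le x) (ltn_ord x))].
exists a, c, k; split.
- apply/catalanP; split=> [|x]; last by rewrite ffunE rk_le.
  by apply/order_preservingP=> x y xy; rewrite !ffunE /= rk_leq b_mono.
- apply/catalanP; split=> [|x]; last by rewrite ffunE unrk_le.
  apply/order_preservingP=> x y xy; rewrite !ffunE /=.
  apply/bigmax_leqP=> z zx; apply: (leq_bigmax_cond (F := fun t => b t : nat)); exact: leq_trans zx xy.
apply/ffunP=> x; apply: val_inj; rewrite transf_mulE ffunE /=.
rewrite iter_mul_alpha''E ffunE /=; last exact: rk_lt.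
(* Rank 0 is not shifted to [k], so [c] acts at 0, where [unrk] vanishes. Here [b x] is the least
   image point, hence 0 because [b] fixes the least point. *)
case: eqP => [rx0|_]; last by rewrite unrkK.
have n_gt0 : 0 < n by apply: leq_ltn_trans (ltn_ord x).
have: rk x <= rk (Ordinal n_gt0) by rewrite rx0.
rewrite rk_leq (b0 (Ordinal n_gt0)) // leqn0 => /eqP->.
by apply/esym/eqP; rewrite -leqn0 unrk_le.
Qed.

End Factorization.

End Generation.

Theorem corollary4p1 (n : nat) (hn : (1 <= n)%N) :
  sgen (catalan n :|: [set alpha'' n]) = order_preserving1 n.
Proof.
apply/setP=> b; apply/mem_sgenP/idP => [|/order_preserving1P[/order_preservingP bO b0] S SM].
  apply; first exact: order_preserving1_mulg_closed.
  by rewrite subUset catalan_sub_order_preserving1 sub1set alpha''_order_preserving1.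
rewrite subUset sub1set => /andP[/subsetP CS alphaS].
have [a [c [m [/CS aS /CS cS ->]]]] := order_preserving_factorization bO b0.
by apply: (SM) cS; elim: m => //= m IHm; apply: SM.
Qed.
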